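(* Let $\mathbb{K}$ be a field; all Hom-Leibniz algebras are multiplicative and over $\mathbb{K}$. a) If $0 \to (M, \alpha_M) \xrightarrow{i} (K,\alpha_K) \xrightarrow{\pi} (L, \alpha_L) \to 0$ is a universal $\alpha$-central extension of Hom-Leibniz algebras, then $HL_1^{\alpha}(K) = HL_2^{\alpha}(K) = 0$. b) If $0 \to (M, \alpha_M) \xrightarrow{i} (K,\alpha_K) \xrightarrow{\pi} (L, \alpha_L) \to 0$ is a central extension of Hom-Leibniz algebras such that $HL_1^{\alpha}(K) = HL_2^{\alpha}(K) = 0$, then it is a universal central extension.
   Context: A (multiplicative) Hom-Leibniz algebra $(L,[-,-],\alpha_L)$, abbreviated $(L,\alpha_L)$, is a $\mathbb{K}$-vector space $L$ with a bilinear map $[-,-]:L\times L\to L$ and a linear map $\alpha_L:L\to L$ such that $[\alpha_L(x),[y,z]]=[[x,y],\alpha_L(z)]-[[x,z],\alpha_L(y)]$ and $\alpha_L[x,y]=[\alpha_L(x),\alpha_L(y)]$ for all $x,y,z\in L$. A homomorphism $f:(L,\alpha_L)\to(L',\alpha_{L'})$ is a linear map preserving brackets with $f\circ\alpha_L=\alpha_{L'}\circ f$. The center is $Z(L)=\{x\in L : [x,y]=0=[y,x] \text{ for all } y\in L\}$. A short exact sequence of Hom-Leibniz algebras $0 \to (M, \alpha_M) \xrightarrow{i} (K,\alpha_K) \xrightarrow{\pi} (L, \alpha_L) \to 0$ (where $M$ is identified with $\ker\pi$ and $\alpha_M$ is the restriction of $\alpha_K$) is called a central extension of $(L,\alpha_L)$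 if $M\subseteq Z(K)$; it is called an $\alpha$-central extension if $\alpha_M(M)\subseteq Z(K)$. A central extension $\pi:(K,\alpha_K)\to(L,\alpha_L)$ is universal (respectively, universal $\alpha$-central) if for every central (respectively, $\alpha$-central) extension $\pi':(K',\alpha_{K'})\to(L,\alpha_L)$ there exists a unique homomorphism of Hom-Leibniz algebras $h:(K,\alpha_K)\to(K',\alpha_{K'})$ with $\pi'\circ h=\pi$. (So a universal $\alpha$-central extension is by definition itself a central extension.) Homology with trivial coefficients in $\mathbb{K}$ in low degrees: $HL_1^{\alpha}(K)=K/[K,K]$, where $[K,K]$ is the span of all brackets, and $HL_2^{\alpha}(K)=\ker d_2/\operatorname{im} d_3$, where $d_2:K\otimes K\to K$, $d_2(x_1\otimes x_2)=-[x_1,x_2]$, and $d_3:K^{\otimes 3}\to K^{\otimes 2}$, $d_3(x_1\otimes x_2\otimes x_3)=-[x_1,x_2]\otimes\alpha_K(x_3)+[x_1,x_3]\otimes\alpha_K(x_2)+\alpha_K(x_1)\otimes[x_2,x_3]$. *)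

(* Defs.v *)
From HB Require Import structures.
From mathcomp Require Import all_boot all_algebra.
From mathcomp Require Import boolp finmap.
From mathcomp.multinomials Require Import monalg.

Set Implicit Arguments.
Unset Strict Implicit.
Unset Printing Implicit Defensive.

Import GRing.Theory.
Local Open Scope ring_scope.
Local Open Scope quotient_scope.

Section Subspaces.
Variable F : fieldType.

Section LinearSubspaces.
Variables (U V : lmodType F) (f : {linear U -> V}).

Definition lin_ker : {pred U} := fun x => f x == 0.

Fact lin_ker_submod : submod_closed lin_ker.
Proof.
split=> [|a x y]; rewrite !unfold_in ?linear0 // => /eqP fx /eqP fy.
by rewrite linearP fx fy scaler0 addr0.
Qed.
HB.instance Definition _ := GRing.isSubmodClosed.Build F U lin_ker lin_ker_submod.

Definition lin_im : {pred V} := fun y => `[< exists x, f x = y >].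

Fact lin_im_submod : submod_closed lin_im.
Proof.
split=> [|a x y]; rewrite !unfold_in; first by apply/asboolP; exists 0; rewrite linear0.
move=> /asboolP[u <-] /asboolP[v <-]; apply/asboolP.
by exists (a *: u + v); rewrite linearP.
Qed.
HB.instance Definition _ := GRing.isSubmodClosed.Build F V lin_im lin_im_submod.

Variable I : submodClosed V.

Definition lin_pre : {pred U} := fun x => f x \in I.

Fact lin_pre_submod : submod_closed lin_pre.
Proof.
have preE x : (x \in lin_pre) = (f x \in I) by [].
split=> [|a x y]; rewrite !preE ?linear0 ?rpred0 // => fx fy.
by rewrite linearP rpredD ?rpredZ.
Qed.
HB.instance Definition _ := GRing.isSubmodClosed.Build F U lin_pre lin_pre_submod.

End LinearSubspaces.

Section Span.
Variables (V : lmodType F) (S : V -> Prop).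

Definition lin_span : {pred V} := fun v =>
  `[< exists s : seq (F * V),
        (forall p, p \in s -> S p.2) /\ v = \sum_(p <- s) p.1 *: p.2 >].

Fact lin_span_submod : submod_closed lin_span.
Proof.
split=> [|a x y]; rewrite !unfold_in.
  by apply/asboolP; exists [::]; rewrite big_nil.
move=> /asboolP[s [sS ->]] /asboolP[t [tS ->]]; apply/asboolP.
exists ([seq (a * p.1, p.2) | p <- s] ++ t); split.
  by move=> p; rewrite mem_cat => /orP[/mapP[q qs ->]|/tS]; [exact: sS qs|].
rewrite big_cat big_map scaler_sumr /=; congr (_ + _).
by apply: eq_bigr => p _; rewrite scalerA.
Qed.
HB.instance Definition _ := GRing.isSubmodClosed.Build F V lin_span lin_span_submod.

Lemma mem_lin_span v : S v -> v \in lin_span.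
Proof.
move=> Sv; rewrite unfold_in; apply/asboolP; exists [:: (1, v)]; split.
  by move=> p; rewrite inE => /eqP ->.
by rewrite big_seq1 scale1r.
Qed.

Lemma lin_spanP (P : submodClosed V) :
  (forall v, S v -> v \in P) -> {subset lin_span <= P}.
Proof.
move=> SP v; rewrite unfold_in => /asboolP[s [sS ->]].
by rewrite big_seq; apply: rpred_sum => p /sS/SP; apply: rpredZ.
Qed.

End Span.

Section SubspaceType.
Variables (V : lmodType F) (I : submodClosed V).

Record subspace := Subspace { subspace_val :> V; _ : subspace_val \in I }.

HB.instance Definition _ := [isSub for subspace_val].
HB.instance Definition _ := [Choice of subspace by <:].
HB.instance Definition _ := [SubChoice_isSubLmodule of subspace by <:].

End SubspaceType.

End Subspaces.

Record quotient_space (F : fieldType) (V : lmodType F) (I : submodClosed V) :=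
  QuotientSpace {
  qs_space : lmodType F;
  qs_pi : {linear V -> qs_space};
  qs_surj : forall q, exists x, qs_pi x = q;
  qs_ker : forall x, qs_pi x = 0 <-> x \in I
}.

Module QuotientConstruction.
Section QuotientConstruction.
Variables (F : fieldType) (V : lmodType F) (I : submodClosed V).

(* [submodClosed] only records closure under the semimodule operations. *)
Fact submod_opp_closed : oppr_closed I.
Proof. by move=> x Ix; rewrite -scaleN1r rpredZ. Qed.
Definition submod_zmod : zmodClosed V := HB.pack (GRing.SubmodClosed.sort I)
  (GRing.isOppClosed.Build V (GRing.SubmodClosed.sort I) submod_opp_closed).

Definition lquot_sort := Quotient.quot submod_zmod.

HB.instance Definition _ := GRing.Zmodule.on lquot_sort.
HB.instance Definition _ : EqQuotient V (Quotient.equiv submod_zmod) lquot_sort :=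
  EqQuotient.on lquot_sort.

Lemma lquot_eq (x y : V) : \pi_lquot_sort x = \pi_lquot_sort y <-> x - y \in I.
Proof.
rewrite -[x - y \in I]/(Quotient.equiv submod_zmod x y).
by split=> [/eqmodP|h]; last exact/eqmodP.
Qed.

Fact lquotD (x y : V) : \pi_lquot_sort (x + y) = \pi_lquot_sort x + \pi_lquot_sort y.
Proof. exact: (Quotient.pi_add submod_zmod x y). Qed.

Definition lquot_scale (a : F) (q : lquot_sort) : lquot_sort := \pi_lquot_sort (a *: repr q).

Fact lquot_scaleE a x : lquot_scale a (\pi_lquot_sort x) = \pi_lquot_sort (a *: x).
Proof.
apply/lquot_eq; rewrite -scalerBr; apply: rpredZ.
by apply/(lquot_eq _ x); rewrite reprK.
Qed.

Fact lquot_scaleA a b q : lquot_scale a (lquot_scale b q) = lquot_scale (a * b) q.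
Proof. by elim/quotW: q => x; rewrite (lquot_scaleE b x) !lquot_scaleE scalerA. Qed.
Fact lquot_scale1 : left_id 1 lquot_scale.
Proof. by elim/quotW=> x; rewrite lquot_scaleE scale1r. Qed.
Fact lquot_scaleDr : right_distributive lquot_scale +%R.
Proof.
move=> a; elim/quotW=> x; elim/quotW=> y.
by rewrite -lquotD !lquot_scaleE scalerDr lquotD.
Qed.
Fact lquot_scaleDl q : {morph lquot_scale^~ q : a b / a + b}.
Proof. by move=> a b; elim/quotW: q => x; rewrite !lquot_scaleE scalerDl lquotD. Qed.

HB.instance Definition _ := GRing.Zmodule_isLmodule.Build F lquot_sort
  lquot_scaleA lquot_scale1 lquot_scaleDr lquot_scaleDl.

Fact lquot_pi_linear : linear (\pi_lquot_sort : V -> lquot_sort).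
Proof. by move=> a x y; rewrite lquotD -lquot_scaleE. Qed.

Definition pi_lin : {linear V -> lquot_sort} :=
  HB.pack (\pi_lquot_sort : V -> lquot_sort)
    (GRing.isLinear.Build F V lquot_sort _ _ lquot_pi_linear).

Fact pi_surj (q : lquot_sort) : exists x, pi_lin x = q.
Proof. by exists (repr q); exact: reprK. Qed.

Fact pi_ker x : pi_lin x = 0 <-> x \in I.
Proof. by rewrite -(linear0 pi_lin) lquot_eq subr0. Qed.

Definition construction := QuotientSpace pi_surj pi_ker.

End QuotientConstruction.
End QuotientConstruction.

(* The construction is sealed: only the characterisation above is available,
   which keeps unification from unfolding it. *)
Lemma quotient_space_exists (F : fieldType) (V : lmodType F) (I : submodClosed V) :
  quotient_space I.
Proof. exact: QuotientConstruction.construction. Qed.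

Section Quotient.
Variables (F : fieldType) (V : lmodType F) (I : submodClosed V).

Definition lquot : lmodType F := qs_space (quotient_space_exists I).
Definition lquot_pi : {linear V -> lquot} := qs_pi (quotient_space_exists I).

Lemma lquot_piP (q : lquot) : exists x, lquot_pi x = q.
Proof. exact: qs_surj. Qed.

Lemma lquot_pi_eq0 x : lquot_pi x = 0 <-> x \in I.
Proof. exact: qs_ker. Qed.

Lemma lquot_lift (W : lmodType F) (f : {linear V -> W}) :
  (forall x, x \in I -> f x = 0) ->
  exists g : {linear lquot -> W}, forall x, g (lquot_pi x) = f x.
Proof.
move=> fI; pose s q := sval (cid (lquot_piP q)).
have sK q : lquot_pi (s q) = q by rewrite /s; case: cid.
pose g q := f (s q).
have gE x : g (lquot_pi x) = f x.
  apply/eqP; rewrite -subr_eq0 -linearB; apply/eqP/fI/lquot_pi_eq0.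
  by rewrite linearB /= sK subrr.
have g_lin : linear g.
  by move=> a p q; rewrite -{1}[p]sK -{1}[q]sK -linearP gE linearP.
pose G : {linear lquot -> W} := HB.pack g (GRing.isLinear.Build F lquot W _ g g_lin).
by exists G.
Qed.

End Quotient.

Record tensor_product (F : fieldType) (V W : lmodType F) := TensorProduct {
  tp_space : lmodType F;
  tp_tens : {bilinear V -> W -> tp_space};
  tp_span : forall t, t \in lin_span (fun t => exists x y, t = tp_tens x y);
  tp_univ : forall (U : lmodType F) (f : {bilinear V -> W -> U}),
    exists g : {linear tp_space -> U}, forall x y, g (tp_tens x y) = f x y
}.

(* The free vector space on [V * W] modulo bilinearity. *)
Module TensorConstruction.
Section TensorConstruction.
Variables (F : fieldType) (V W : lmodType F).

Local Notation free := {malg F[(V * W)%type]}.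

Definition free_gen (x : V) (y : W) : free := << (x, y) >>.

Inductive tensor_rel : free -> Prop :=
| TensorRelL a x x' y :
    tensor_rel (free_gen (a *: x + x') y - (a *: free_gen x y + free_gen x' y))
| TensorRelR a x y y' :
    tensor_rel (free_gen x (a *: y + y') - (a *: free_gen x y + free_gen x y')).

Definition tensor : lmodType F := lquot (lin_span tensor_rel).

Definition tens (x : V) (y : W) : tensor := lquot_pi _ (free_gen x y).

Fact tens_bilinear : bilinear_for *:%R *:%R tens.
Proof.
have piP a g h k : tensor_rel (k - (a *: g + h)) ->
    lquot_pi (lin_span tensor_rel) k
    = a *: lquot_pi (lin_span tensor_rel) g + lquot_pi (lin_span tensor_rel) h.
  by move=> r; rewrite -linearP; apply/eqP; rewrite -subr_eq0 -linearB;
    apply/eqP/lquot_pi_eq0/mem_lin_span.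
split=> [y|x] a u v; apply: (piP).
  exact: TensorRelL.
exact: TensorRelR.
Qed.
HB.instance Definition _ :=
  bilinear_isBilinear.Build F V W tensor _ _ tens tens_bilinear.

Fact tens_span t : t \in lin_span (fun t => exists x y, t = tens x y).
Proof.
have [g <-] := lquot_piP t; rewrite [g]monalgE linear_sum; apply: rpred_sum => k _.
have -> : << g@_k *g k >> = g@_k *: free_gen k.1 k.2.
  by apply/malgP => j; case: k => x y; rewrite mcoeffZ !mcoeffU mulrnAr mulr1.
by rewrite linearZ; apply/rpredZ/mem_lin_span; exists k.1, k.2.
Qed.

Section Lift.
Variables (U : lmodType F) (f : {bilinear V -> W -> U}).

Definition free_lift (g : free) : U := \sum_(k <- msupp g) g@_k *: f k.1 k.2.

Fact free_liftEw (g : free) (d : {fset (V * W)%type}) : (msupp g `<=` d)%fset ->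
  free_lift g = \sum_(k <- d) g@_k *: f k.1 k.2.
Proof.
move=> le_gd; apply: big_fset_incl => // k _ /mcoeff_outdom ->.
by rewrite scale0r.
Qed.

Fact free_lift_linear : linear free_lift.
Proof.
move=> a g h; pose d := (msupp g `|` msupp h)%fset.
have le_s : (msupp (a *: g + h) `<=` d)%fset.
  apply: (fsubset_trans (msuppD_le _ _)); apply: fsetUSS => //.
  exact: msuppZ_le.
rewrite (free_liftEw le_s) (free_liftEw (fsubsetUl _ _ : (msupp g `<=` d)%fset)).
rewrite (free_liftEw (fsubsetUr _ _ : (msupp h `<=` d)%fset)).
rewrite scaler_sumr -big_split; apply: eq_bigr => k _ /=.
by rewrite mcoeffD mcoeffZ scalerDl scalerA.
Qed.
HB.instance Definition _ :=
  GRing.isLinear.Build F free U _ free_lift free_lift_linear.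

Lemma free_liftU x y : free_lift (free_gen x y) = f x y.
Proof.
rewrite (free_liftEw msuppU_le) big_seq_fset1 mcoeffUU /=.
by rewrite scale1r.
Qed.

Fact free_lift_rel g : g \in lin_span tensor_rel -> free_lift g = 0.
Proof.
move=> gS; apply/eqP; rewrite -[_ == 0]/(g \in lin_ker free_lift).
move: g gS; apply: lin_spanP => g [a x x' y|a x y y']; rewrite unfold_in; apply/eqP.
  by rewrite linearB (linearP free_lift) /= !free_liftU linearPl subrr.
by rewrite linearB (linearP free_lift) /= !free_liftU linearPr subrr.
Qed.

Fact tensor_univ :
  exists g : {linear tensor -> U}, forall x y, g (tens x y) = f x y.
Proof.
have [g gE] := lquot_lift free_lift_rel.
by exists g => x y; rewrite gE; exact: free_liftU.
Qed.

End Lift.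

Definition construction := TensorProduct tens_span tensor_univ.

End TensorConstruction.
End TensorConstruction.

Lemma tensor_product_exists (F : fieldType) (V W : lmodType F) :
  tensor_product V W.
Proof. exact: TensorConstruction.construction. Qed.

Section Tensor.
Variables (F : fieldType) (V W : lmodType F).

Definition tensor : lmodType F := tp_space (tensor_product_exists V W).
Definition tens : {bilinear V -> W -> tensor} :=
  tp_tens (tensor_product_exists V W).

Lemma tensor_ind (P : tensor -> Prop) :
  (forall x y, P (tens x y)) ->
  (forall a t u, P t -> P u -> P (a *: t + u)) -> forall t, P t.
Proof.
move=> Ptens Plin t.
have P0 : P 0.
  by have := Plin (-1) _ _ (Ptens 0 0) (Ptens 0 0); rewrite scaleN1r addNr.
have := tp_span t; rewrite unfold_in => /asboolP[s [sS ->]].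
elim: s sS => [|p s IH] sS; first by rewrite big_nil.
rewrite big_cons; apply: Plin; last first.
  by apply: IH => q qs; apply: sS; rewrite inE qs orbT.
by have [x [y ->]] := sS p (mem_head _ _); apply: Ptens.
Qed.

Definition tensor_lift (U : lmodType F) (f : {bilinear V -> W -> U}) :
    {linear tensor -> U} :=
  sval (cid (tp_univ (tensor_product_exists V W) f)).

Lemma tensor_liftE (U : lmodType F) (f : {bilinear V -> W -> U}) x y :
  tensor_lift f (tens x y) = f x y.
Proof. by rewrite /tensor_lift; case: cid. Qed.

End Tensor.
Arguments tens {F V W}.

HB.mixin Record isHomLeibniz (F : fieldType) L of GRing.Lmodule F L := {
  hl_br : {bilinear L -> L -> L};
  hl_alpha : {linear L -> L};
  hl_homleibniz : forall x y z : L,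
    hl_br (hl_alpha x) (hl_br y z) =
    hl_br (hl_br x y) (hl_alpha z) - hl_br (hl_br x z) (hl_alpha y);
  hl_multiplicative : forall x y : L,
    hl_alpha (hl_br x y) = hl_br (hl_alpha x) (hl_alpha y)
}.

#[short(type="homLeibnizType")]
HB.structure Definition HomLeibniz (F : fieldType) :=
  {L of GRing.Lmodule F L & isHomLeibniz F L}.

HB.mixin Record isHomLeibnizMorphism (F : fieldType) (K L : homLeibnizType F)
    (f : K -> L) := {
  hlmorph_br : forall x y, f (hl_br x y) = hl_br (f x) (f y);
  hlmorph_alpha : forall x, f (hl_alpha x) = hl_alpha (f x)
}.

HB.structure Definition HomLeibnizMorphism (F : fieldType)
    (K L : homLeibnizType F) :=
  {f of @GRing.Linear F K L *:%R f & isHomLeibnizMorphism F K L f}.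

Notation "{ 'hlmorphism' K -> L }" := (HomLeibnizMorphism.type K L)
  (at level 0, K at level 98, L at level 99,
   format "{ 'hlmorphism'  K  ->  L }") : type_scope.

Section Extensions.
Variable F : fieldType.

Definition hl_central (K : homLeibnizType F) (x : K) : Prop :=
  forall y : K, hl_br x y = 0 /\ hl_br y x = 0.

Section Extension.
Variables (M K L : homLeibnizType F).
Variables (i : {hlmorphism M -> K}) (pi : {hlmorphism K -> L}).

Definition short_exact : Prop :=
  [/\ injective i,
      forall x : K, pi x = 0 <-> exists m : M, i m = x
    & forall y : L, exists x : K, pi x = y].

Definition central_extension : Prop :=
  short_exact /\ forall m : M, hl_central (i m).

Definition alpha_central_extension : Prop :=
  short_exact /\ forall m : M, hl_central (i (hl_alpha m)).

End Extension.

Definition unique_lift (K K' L : homLeibnizType F)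
    (pi : {hlmorphism K -> L}) (pi' : {hlmorphism K' -> L}) : Prop :=
  exists h : {hlmorphism K -> K'}, (forall x, pi' (h x) = pi x) /\
    forall h' : {hlmorphism K -> K'}, (forall x, pi' (h' x) = pi x) -> h' =1 h.

Definition universal_central_extension (M K L : homLeibnizType F)
    (i : {hlmorphism M -> K}) (pi : {hlmorphism K -> L}) : Prop :=
  central_extension i pi /\
  forall (M' K' : homLeibnizType F)
      (i' : {hlmorphism M' -> K'}) (pi' : {hlmorphism K' -> L}),
    central_extension i' pi' -> unique_lift pi pi'.

(* The extension itself is required to be central; only the test extensions
   range over the alpha-central ones. *)
Definition universal_alpha_central_extension (M K L : homLeibnizType F)
    (i : {hlmorphism M -> K}) (pi : {hlmorphism K -> L}) : Prop :=
  central_extension i pi /\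
  forall (M' K' : homLeibnizType F)
      (i' : {hlmorphism M' -> K'}) (pi' : {hlmorphism K' -> L}),
    alpha_central_extension i' pi' -> unique_lift pi pi'.

End Extensions.

Section Homology.
Variables (F : fieldType) (K : homLeibnizType F).

Definition hl_derived : submodClosed K :=
  lin_span (fun v : K => exists x y : K, v = hl_br x y).

Definition HL1 : lmodType F := lquot hl_derived.

Definition neg_br (x y : K) : K := - hl_br x y.
Fact neg_br_bilinear : bilinear_for *:%R *:%R neg_br.
Proof.
by split=> [y|x] a u v; rewrite /neg_br ?linearPl ?linearPr /= opprD scalerN.
Qed.
HB.instance Definition _ :=
  bilinear_isBilinear.Build F K K K _ _ neg_br neg_br_bilinear.

Definition d2 : {linear tensor K K -> K} := tensor_lift neg_br.

Lemma d2E x1 x2 : d2 (tens x1 x2) = - hl_br x1 x2.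
Proof. exact: tensor_liftE. Qed.

Fact hl_brDl a u v (y : K) : hl_br (a *: u + v) y = a *: hl_br u y + hl_br v y.
Proof. exact: linearPl. Qed.
Fact hl_brDr a u v (x : K) : hl_br x (a *: u + v) = a *: hl_br x u + hl_br x v.
Proof. exact: linearPr. Qed.
Fact tensDl a u v (y : K) :
  tens (a *: u + v) y = a *: tens u y + tens v y :> tensor K K.
Proof. exact: linearPl. Qed.
Fact tensDr a u v (x : K) :
  tens x (a *: u + v) = a *: tens x u + tens x v :> tensor K K.
Proof. exact: linearPr. Qed.
Fact addr3_comb (V : lmodType F) (a : F) (x y z x' y' z' : V) :
  - (a *: x + x') + (a *: y + y') + (a *: z + z') =
  a *: (- x + y + z) + (- x' + y' + z').
Proof.
by rewrite !scalerDr scalerN opprD (addrACA (- (a *: x))) (addrACA (_ + _)).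
Qed.

(* The triple tensor power is taken to be (K (x) K) (x) K, so d3 is obtained by
   lifting in (x1, x2) first, for fixed x3. *)
Definition d3_tri (x3 x1 x2 : K) : tensor K K :=
  - tens (hl_br x1 x2) (hl_alpha x3) + tens (hl_br x1 x3) (hl_alpha x2)
  + tens (hl_alpha x1) (hl_br x2 x3).

Fact d3_tri_bilinear x3 : bilinear_for *:%R *:%R (d3_tri x3).
Proof.
split=> [y|x] a u v; rewrite /d3_tri; last 1 first.
  by rewrite hl_brDr linearP /= hl_brDl !tensDl !tensDr; apply: addr3_comb.
by rewrite linearP /= !hl_brDl !tensDl; apply: addr3_comb.
Qed.
HB.instance Definition _ x3 :=
  bilinear_isBilinear.Build F K K _ _ _ (d3_tri x3) (d3_tri_bilinear x3).

Definition d3_bi (t : tensor K K) (x3 : K) : tensor K K :=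
  tensor_lift (d3_tri x3) t.

Fact d3_bi_tens x1 x2 x3 : d3_bi (tens x1 x2) x3 = d3_tri x3 x1 x2.
Proof. exact: tensor_liftE. Qed.

Fact d3_bi_linearl x3 : linear (d3_bi^~ x3).
Proof. by move=> a s t; exact: (linearP (tensor_lift (d3_tri x3))). Qed.

Fact d3_tri_linear x1 x2 : linear (fun x3 => d3_tri x3 x1 x2).
Proof.
move=> a u v; rewrite /d3_tri (linearP hl_alpha) /= !hl_brDr !tensDr !tensDl.
exact: addr3_comb.
Qed.

Fact d3_bi_bilinear : bilinear_for *:%R *:%R d3_bi.
Proof.
split=> [|t] //= a u v; first exact: d3_bi_linearl.
elim/tensor_ind: t => [x1 x2|b s t IHs IHt].
  by rewrite !d3_bi_tens d3_tri_linear.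
rewrite !d3_bi_linearl IHs IHt !scalerDr !scalerA (mulrC b).
by rewrite addrACA.
Qed.
HB.instance Definition _ :=
  bilinear_isBilinear.Build F _ K _ _ _ d3_bi d3_bi_bilinear.

Definition d3 : {linear tensor (tensor K K) K -> tensor K K} := tensor_lift d3_bi.

Lemma d3E x1 x2 x3 : d3 (tens (tens x1 x2) x3) =
  - tens (hl_br x1 x2) (hl_alpha x3) + tens (hl_br x1 x3) (hl_alpha x2)
  + tens (hl_alpha x1) (hl_br x2 x3).
Proof. exact: etrans (tensor_liftE _ _ _) (d3_bi_tens _ _ _). Qed.

Lemma d2_d3 t : d2 (d3 t) = 0.
Proof.
have dP a s u : d2 (d3 (a *: s + u)) = a *: d2 (d3 s) + d2 (d3 u).
  by rewrite (linearP d3) (linearP d2).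
elim/tensor_ind: t => [s x3|a s t IHs IHt]; last first.
  by rewrite dP IHs IHt scaler0 addr0.
elim/tensor_ind: s => [x1 x2|a s t IHs IHt]; last first.
  by rewrite linearPl dP IHs IHt scaler0 addr0.
rewrite d3E !(linearD d2) (linearN d2) /= !d2E hl_homleibniz opprK.
exact: subrr.
Qed.

(* [im d3] is contained in [ker d2] by [d2_d3]; [lin_pre val] views it there. *)
Definition HL2_cycles : lmodType F := subspace (lin_ker d2).

Definition HL2 : lmodType F :=
  lquot (lin_pre (val : HL2_cycles -> tensor K K) (lin_im d3)).

End Homology.
Arguments d2 {F} K.
Arguments d3 {F} K.
Arguments HL1 {F} K.
Arguments HL2 {F} K.

(* Main.v *)
(** The first half compares lifts to suitable alpha-central extensions of [L].
    Against [L * K/[K,K]], the lifts [(pi, 0)] and [(pi, class)] must agree, so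
    [K] is perfect. Then let [Q := (K (x) K) / im d3] ([bcover] below), with bracket
    [[s, t] := u s (x) u t] for [u : Q -> K] induced by the bracket of [K].  The
    kernel of [pi u] is alpha-central, since
    [alpha m (x) [a, b] = [m, a] (x) alpha b - [m, b] (x) alpha a] modulo
    [im d3].  The lift [h : K -> Q] satisfies [u h = id] by uniqueness, and
    [h u = id] because both sides agree on brackets and [Q] is perfect; hence
    [u] is injective, i.e. [HL2 K = 0].

    For the second half, sending [x (x) y] to [[x', y']], where [x'], [y'] are
    any preimages of [pi x], [pi y] in a central extension, kills
    [im d3 = ker d2], so it factors through the surjection [- d2]; the factor
    is the required lift. *)
Require Import Defs.
From HB Require Import structures.
From mathcomp Require Import all_boot all_algebra.
From mathcomp Require Import boolp.
Local Open Scope ring_scope.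

Set Implicit Arguments.
Unset Strict Implicit.
Unset Printing Implicit Defensive.

Import GRing.Theory.

(** * Linear maps determined on generators or factored through surjections *)

Section LinearAlgebra.
Variable F : fieldType.

Definition linear_of (V W : lmodType F) (f : V -> W) (lf : linear f) :
    {linear V -> W} :=
  HB.pack f (GRing.isLinear.Build F V W *:%R f lf).

Definition bilinear_of (U V W : lmodType F) (f : U -> V -> W)
    (bf : bilinear_for *:%R *:%R f) : {bilinear U -> V -> W} :=
  HB.pack f (bilinear_isBilinear.Build F U V W *:%R *:%R f bf).

(** An arbitrary choice of preimages under [p] becomes linear after applying [f], since [f] is
    constant on the fibres of [p]. *)
Lemma linear_factor (V W U : lmodType F) (p : {linear V -> W})
    (f : {linear V -> U}) :
  (forall w, exists v, p v = w) -> (forall v, p v = 0 -> f v = 0) ->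
  exists g : {linear W -> U}, forall v, g (p v) = f v.
Proof.
move=> psurj pf; pose s w := sval (cid (psurj w)).
have sK w : p (s w) = w by rewrite /s; case: cid.
have fE v v' : p v = p v' -> f v = f v'.
  by move=> e; apply/eqP; rewrite -subr_eq0 -linearB pf // linearB /= e subrr.
have lg : linear (fun w => f (s w)).
  by move=> a v w; rewrite -linearP; apply: fE; rewrite linearP !sK.
by exists (linear_of lg) => v; apply: fE; rewrite sK.
Qed.

Lemma span_linear_eq (V W : lmodType F) (S : V -> Prop) (f g : {linear V -> W}) :
  (forall v, S v -> f v = g v) -> forall v, v \in lin_span S -> f v = g v.
Proof.
move=> fg v; rewrite unfold_in => /asboolP[s [sS ->]].
rewrite !linear_sum big_seq [RHS]big_seq; apply: eq_bigr => p /sS/fg e.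
by rewrite !linearZ /= e.
Qed.

Lemma tensor_linear_eq (V W U : lmodType F) (f g : {linear tensor V W -> U}) :
  (forall x y, f (tens x y) = g (tens x y)) -> f =1 g.
Proof.
move=> fg; elim/tensor_ind => // a s t fs ft.
by rewrite (linearP f) (linearP g) fs ft.
Qed.

End LinearAlgebra.

(** * Perfect algebras and the vanishing of [HL1] and [HL2] *)

Section HomLeibnizTheory.
Variable F : fieldType.
Implicit Types K L : homLeibnizType F.

Definition hlmorphism_of K L (f : {linear K -> L})
    (fbr : forall x y, f (hl_br x y) = hl_br (f x) (f y))
    (falpha : forall x, f (hl_alpha x) = hl_alpha (f x)) : {hlmorphism K -> L} :=
  HB.pack (f : K -> L) f (isHomLeibnizMorphism.Build F K L f fbr falpha).

Definition perfect K : Prop := forall x : K, x \in hl_derived K.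

Lemma perfect_linear_eq K (W : lmodType F) (f g : {linear K -> W}) :
  perfect K -> (forall x y, f (hl_br x y) = g (hl_br x y)) -> f =1 g.
Proof.
move=> pK fg x; apply: span_linear_eq (pK x) => v [y [z ->]]; exact: fg.
Qed.

Lemma HL1_eq0 K : (forall x : HL1 K, x = 0) <-> perfect K.
Proof.
split=> [H x|pK q]; first exact/lquot_pi_eq0/H.
by have [x <-] := lquot_piP q; apply/lquot_pi_eq0/pK.
Qed.

(** Unfolds the subquotient into exactness at the middle term, the form in which both halves use
    it. *)
Lemma HL2_eq0 K :
  (forall x : HL2 K, x = 0) <-> forall t, d2 K t = 0 -> exists s, d3 K s = t.
Proof.
split=> [H t dt|H q].
  have kt : t \in lin_ker (d2 K) by rewrite unfold_in dt.
  pose z : HL2_cycles K := Subspace kt.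
  have /lquot_pi_eq0 := H (lquot_pi _ z).
  by rewrite unfold_in unfold_in => /asboolP.
have [z <-] := lquot_piP q; apply/lquot_pi_eq0.
rewrite unfold_in unfold_in; apply/asboolP; apply: H.
by apply/eqP; have := valP z; rewrite unfold_in.
Qed.

(** Pure tensors span the triple tensor power, and [d3] is explicit on them. This is how a map is
    shown to descend modulo [im d3]. *)
Lemma linear_d3_eq0 K (W : lmodType F) (f : {linear tensor K K -> W}) :
  (forall x y z, f (- tens (hl_br x y) (hl_alpha z) + tens (hl_br x z) (hl_alpha y)
                    + tens (hl_alpha x) (hl_br y z)) = 0) ->
  forall t, f (d3 K t) = 0.
Proof.
move=> f0 t; elim/tensor_ind: t => [s z|a s t IHs IHt]; last first.
  by rewrite (linearP (d3 K)) (linearP f) IHs IHt scaler0 addr0.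
elim/tensor_ind: s => [x y|a s t IHs IHt]; first by rewrite d3E f0.
by rewrite linearPl (linearP (d3 K)) (linearP f) IHs IHt scaler0 addr0.
Qed.

Lemma d2_surj K : perfect K -> forall x, exists t, d2 K t = x.
Proof.
move=> pK x; suff : x \in lin_im (d2 K) by rewrite unfold_in => /asboolP.
move: (pK x); apply: lin_spanP => v [y [z ->]]; rewrite unfold_in; apply/asboolP.
by exists (- tens y z); rewrite linearN /= d2E opprK.
Qed.

End HomLeibnizTheory.

(** * Kernels of homomorphisms as Hom-Leibniz algebras *)

Section Kernel.
Variables (F : fieldType) (K L : homLeibnizType F) (f : {hlmorphism K -> L}).

Definition hlker : Type := subspace (lin_ker f).
HB.instance Definition _ := GRing.Lmodule.on hlker.

Lemma mem_hlker (x : K) : (x \in lin_ker f) = (f x == 0).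
Proof. by []. Qed.

Lemma hlker_val (x : hlker) : f (val x) = 0.
Proof. by apply/eqP; rewrite -mem_hlker; exact: valP. Qed.

Fact hlker_br_subproof (x y : hlker) : hl_br (val x) (val y) \in lin_ker f.
Proof. by rewrite mem_hlker hlmorph_br !hlker_val linear0r. Qed.

Fact hlker_alpha_subproof (x : hlker) : hl_alpha (val x) \in lin_ker f.
Proof. by rewrite mem_hlker hlmorph_alpha hlker_val linear0. Qed.

Definition hlker_br (x y : hlker) : hlker := Subspace (hlker_br_subproof x y).
Definition hlker_alpha (x : hlker) : hlker := Subspace (hlker_alpha_subproof x).

Fact hlker_val_linear : linear (val : hlker -> K).
Proof. by []. Qed.

Fact hlker_br_bilinear : bilinear_for *:%R *:%R hlker_br.
Proof.
by split=> [y|x] a u v; apply: val_inj; rewrite /= ?linearPl ?linearPr.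
Qed.

Fact hlker_alpha_linear : linear hlker_alpha.
Proof. by move=> a u v; apply: val_inj; rewrite /= linearP. Qed.

Fact hlker_homleibniz (x y z : hlker) :
  hlker_br (hlker_alpha x) (hlker_br y z) =
  hlker_br (hlker_br x y) (hlker_alpha z) - hlker_br (hlker_br x z) (hlker_alpha y).
Proof. by apply: val_inj; rewrite /= hl_homleibniz. Qed.

Fact hlker_multiplicative (x y : hlker) :
  hlker_alpha (hlker_br x y) = hlker_br (hlker_alpha x) (hlker_alpha y).
Proof. by apply: val_inj; rewrite /= hl_multiplicative. Qed.

HB.instance Definition _ := isHomLeibniz.Build F hlker
  (hl_br := bilinear_of hlker_br_bilinear)
  (hl_alpha := linear_of hlker_alpha_linear)
  hlker_homleibniz hlker_multiplicative.

Definition hlker_incl : {hlmorphism hlker -> K} :=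
  @hlmorphism_of F hlker K (linear_of hlker_val_linear)
    (fun _ _ => erefl) (fun _ => erefl).

(** Extensions are stated with a separate kernel algebra; this provides one, so that a test
    extension can be given by its projection alone. *)
Lemma hlker_exact : (forall y, exists x, f x = y) -> short_exact hlker_incl f.
Proof.
move=> fsurj; split=> //; first exact: val_inj.
move=> x; split=> [fx|[m <-]]; last exact: hlker_val.
have kx : x \in lin_ker f by rewrite mem_hlker fx.
by exists (Subspace kx).
Qed.

End Kernel.

(** * Direct products and pairings of homomorphisms *)

Section Product.
Variables (F : fieldType) (K L : homLeibnizType F).

Definition hlprod : Type := (K * L)%type.
HB.instance Definition _ := GRing.Lmodule.on hlprod.

Definition hlprod_br (x y : hlprod) : hlprod := (hl_br x.1 y.1, hl_br x.2 y.2).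
Definition hlprod_alpha (x : hlprod) : hlprod := (hl_alpha x.1, hl_alpha x.2).

Fact hlprod_br_bilinear : bilinear_for *:%R *:%R hlprod_br.
Proof.
by split=> [y|x] a u v; apply/pair_equal_spec; rewrite ?hl_brDl ?hl_brDr.
Qed.

Fact hlprod_alpha_linear : linear hlprod_alpha.
Proof. by move=> a u v; apply/pair_equal_spec; rewrite !linearP. Qed.

Fact hlprod_homleibniz (x y z : hlprod) :
  hlprod_br (hlprod_alpha x) (hlprod_br y z) =
  hlprod_br (hlprod_br x y) (hlprod_alpha z)
  - hlprod_br (hlprod_br x z) (hlprod_alpha y).
Proof. by apply/pair_equal_spec; rewrite /= !hl_homleibniz. Qed.

Fact hlprod_multiplicative (x y : hlprod) :
  hlprod_alpha (hlprod_br x y) = hlprod_br (hlprod_alpha x) (hlprod_alpha y).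
Proof. by apply/pair_equal_spec; rewrite !hl_multiplicative. Qed.

HB.instance Definition _ := isHomLeibniz.Build F hlprod
  (hl_br := bilinear_of hlprod_br_bilinear)
  (hl_alpha := linear_of hlprod_alpha_linear)
  hlprod_homleibniz hlprod_multiplicative.

Fact hlprod_fst_linear : linear (fst : hlprod -> K).
Proof. by []. Qed.

Definition hlprod_fst : {hlmorphism hlprod -> K} :=
  @hlmorphism_of F hlprod K (linear_of hlprod_fst_linear)
    (fun _ _ => erefl) (fun _ => erefl).

Section Pairing.
Variables (E : homLeibnizType F) (f : {hlmorphism E -> K}) (g : {hlmorphism E -> L}).

Definition hlpair (x : E) : hlprod := (f x, g x).

Fact hlpair_linear : linear hlpair.
Proof. by move=> a u v; apply/pair_equal_spec; rewrite !linearP. Qed.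

Fact hlpair_br x y : hlpair (hl_br x y) = hl_br (hlpair x) (hlpair y).
Proof. by apply/pair_equal_spec; rewrite !hlmorph_br. Qed.

Fact hlpair_alpha x : hlpair (hl_alpha x) = hl_alpha (hlpair x).
Proof. by apply/pair_equal_spec; rewrite !hlmorph_alpha. Qed.

Definition hlpair_morph : {hlmorphism E -> hlprod} :=
  @hlmorphism_of F E hlprod (linear_of hlpair_linear) hlpair_br hlpair_alpha.

End Pairing.
End Product.

Section ZeroMorphism.
Variables (F : fieldType) (K L : homLeibnizType F).

Fact hlzero_linear : linear (fun _ : K => 0 : L).
Proof. by move=> a u v; rewrite scaler0 addr0. Qed.

Fact hlzero_br (x y : K) : 0 = hl_br (0 : L) (0 : L).
Proof. by rewrite linear0r. Qed.

Fact hlzero_alpha (x : K) : 0 = hl_alpha (0 : L).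
Proof. by rewrite linear0. Qed.

Definition hlzero : {hlmorphism K -> L} :=
  hlmorphism_of (f := linear_of hlzero_linear) hlzero_br hlzero_alpha.

End ZeroMorphism.

(** * The abelianization [K/[K,K]] with zero bracket *)

Section Abelianization.
Variables (F : fieldType) (K : homLeibnizType F).

Definition abelianization : Type := HL1 K.
HB.instance Definition _ := GRing.Lmodule.on abelianization.

Definition ab_pi : {linear K -> abelianization} := lquot_pi (hl_derived K).

Lemma ab_pi_br x y : ab_pi (hl_br x y) = 0.
Proof. by apply/lquot_pi_eq0/mem_lin_span; exists x, y. Qed.

Definition ab_pi_alpha (x : K) : abelianization := ab_pi (hl_alpha x).

Fact ab_pi_alpha_linear : linear ab_pi_alpha.
Proof. by move=> a u v; rewrite /ab_pi_alpha !linearP. Qed.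

(** By multiplicativity [hl_alpha] sends brackets to brackets, so it preserves [[K,K]]. *)
Fact ab_alpha_exists : exists g : {linear abelianization -> abelianization},
  forall x, g (ab_pi x) = ab_pi (hl_alpha x).
Proof.
apply: (linear_factor (f := linear_of ab_pi_alpha_linear)) => [q|x].
  exact: lquot_piP.
move=> /lquot_pi_eq0; apply: (span_linear_eq (g := \0)) => v [y [z ->]].
by rewrite /= /ab_pi_alpha hl_multiplicative ab_pi_br.
Qed.

Definition ab_alpha : {linear abelianization -> abelianization} :=
  sval (cid ab_alpha_exists).

Lemma ab_alphaE x : ab_alpha (ab_pi x) = ab_pi (hl_alpha x).
Proof. by rewrite /ab_alpha; case: cid. Qed.

Definition ab_br (x y : abelianization) : abelianization := 0.

Fact ab_br_bilinear : bilinear_for *:%R *:%R ab_br.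
Proof. by split=> [y|x] a u v; rewrite /ab_br /= scaler0 addr0. Qed.

Fact ab_homleibniz (x y z : abelianization) :
  ab_br (ab_alpha x) (ab_br y z) =
  ab_br (ab_br x y) (ab_alpha z) - ab_br (ab_br x z) (ab_alpha y).
Proof. by rewrite /ab_br subrr. Qed.

Fact ab_multiplicative (x y : abelianization) :
  ab_alpha (ab_br x y) = ab_br (ab_alpha x) (ab_alpha y).
Proof. exact: linear0. Qed.

HB.instance Definition _ := isHomLeibniz.Build F abelianization
  (hl_br := bilinear_of ab_br_bilinear) (hl_alpha := ab_alpha)
  ab_homleibniz ab_multiplicative.

Definition ab_morph : {hlmorphism K -> abelianization} :=
  @hlmorphism_of F K abelianization ab_pi ab_pi_br
    (fun x => esym (ab_alphaE x)).

End Abelianization.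

(** * The cover of [K] by [K (x) K] modulo [im d3] *)

Section BracketCover.
Variables (F : fieldType) (K : homLeibnizType F).

Definition bcover : Type := lquot (lin_im (d3 K)).
HB.instance Definition _ := GRing.Lmodule.on bcover.

Definition bcover_pi : {linear tensor K K -> bcover} := lquot_pi (lin_im (d3 K)).
Definition btens (x y : K) : bcover := bcover_pi (tens x y).

Lemma bcover_piP (s : bcover) : exists t, bcover_pi t = s.
Proof. exact: lquot_piP. Qed.

Lemma bcover_pi_eq0 t : bcover_pi t = 0 <-> exists s, d3 K s = t.
Proof.
split=> [/lquot_pi_eq0|ds]; first by rewrite unfold_in => /asboolP.
by apply/lquot_pi_eq0; rewrite unfold_in; apply/asboolP.
Qed.

Fact btens_bilinear : bilinear_for *:%R *:%R btens.
Proof.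
by split=> [y|x] a u v; rewrite /btens ?tensDl ?tensDr; exact: linearP.
Qed.
HB.instance Definition _ :=
  bilinear_isBilinear.Build F K K bcover _ _ btens btens_bilinear.

(** The class of [d3 (x (x) y (x) z)] is zero; rearranged, this has the shape of the Hom-Leibniz
    identity. *)
Lemma btens_alpha_br x y z :
  btens (hl_alpha x) (hl_br y z) =
  btens (hl_br x y) (hl_alpha z) - btens (hl_br x z) (hl_alpha y).
Proof.
have : bcover_pi (d3 K (tens (tens x y) z)) = 0.
  by apply/bcover_pi_eq0; exists (tens (tens x y) z).
rewrite d3E !linearD linearN /= => /addr0_eq e.
by rewrite -[LHS]e opprD opprK.
Qed.

Lemma bcover_linear_eq (W : lmodType F) (f g : {linear bcover -> W}) :
  (forall x y, f (btens x y) = g (btens x y)) -> f =1 g.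
Proof.
move=> fg s; have [t <-] := bcover_piP s.
exact: (tensor_linear_eq (f := f \o bcover_pi) (g := g \o bcover_pi)).
Qed.

(** [d2] kills boundaries, hence descends; the sign makes the class of [x (x) y] go to [[x, y]]. *)
Fact bcover_proj_exists : exists g : {linear bcover -> K},
  forall t, g (bcover_pi t) = - d2 K t.
Proof.
apply: (linear_factor (f := \- d2 K)) => [|t /bcover_pi_eq0[s <-]].
  exact: bcover_piP.
by rewrite /= d2_d3 oppr0.
Qed.

Definition bcover_proj : {linear bcover -> K} := sval (cid bcover_proj_exists).

Lemma bcover_projE t : bcover_proj (bcover_pi t) = - d2 K t.
Proof. by rewrite /bcover_proj; case: cid. Qed.

Lemma bcover_proj_btens x y : bcover_proj (btens x y) = hl_br x y.
Proof. by rewrite bcover_projE d2E opprK. Qed.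

Definition btens_alpha (x y : K) : bcover := btens (hl_alpha x) (hl_alpha y).

Fact btens_alpha_bilinear : bilinear_for *:%R *:%R btens_alpha.
Proof.
by split=> [y|x] a u v; rewrite /btens_alpha linearP ?linearPl ?linearPr.
Qed.

(** By multiplicativity, [alpha (x) alpha] carries the relation for [x, y, z] to the relation for
    their images under [hl_alpha]. *)
Fact bcover_alpha_exists : exists g : {linear bcover -> bcover},
  forall x y, g (btens x y) = btens (hl_alpha x) (hl_alpha y).
Proof.
pose f := tensor_lift (bilinear_of btens_alpha_bilinear).
have fE x y : f (tens x y) = btens (hl_alpha x) (hl_alpha y).
  exact: tensor_liftE.
have [|t /bcover_pi_eq0[s <-]|g gE] := linear_factor (p := bcover_pi) (f := f).
- exact: bcover_piP.
- apply: linear_d3_eq0 => x y z; rewrite !linearD linearN /= !fE.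
  by rewrite !hl_multiplicative btens_alpha_br (addrC (- _)) addrA subrK subrr.
- by exists g => x y; rewrite gE fE.
Qed.

Definition bcover_alpha : {linear bcover -> bcover} :=
  sval (cid bcover_alpha_exists).

Lemma bcover_alphaE x y :
  bcover_alpha (btens x y) = btens (hl_alpha x) (hl_alpha y).
Proof. by rewrite /bcover_alpha; case: cid. Qed.

Lemma bcover_proj_alpha s : bcover_proj (bcover_alpha s) = hl_alpha (bcover_proj s).
Proof.
apply: (bcover_linear_eq (f := bcover_proj \o bcover_alpha)
  (g := hl_alpha \o bcover_proj)) => x y /=.
by rewrite bcover_alphaE !bcover_proj_btens hl_multiplicative.
Qed.

Definition bcover_br (s t : bcover) : bcover :=
  btens (bcover_proj s) (bcover_proj t).

Fact bcover_br_bilinear : bilinear_for *:%R *:%R bcover_br.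
Proof.
by split=> [y|x] a u v; rewrite /bcover_br linearP ?linearPl ?linearPr.
Qed.

Fact bcover_homleibniz (x y z : bcover) :
  bcover_br (bcover_alpha x) (bcover_br y z) =
  bcover_br (bcover_br x y) (bcover_alpha z)
  - bcover_br (bcover_br x z) (bcover_alpha y).
Proof.
by rewrite /bcover_br !bcover_proj_alpha !bcover_proj_btens btens_alpha_br.
Qed.

Fact bcover_multiplicative (x y : bcover) :
  bcover_alpha (bcover_br x y) = bcover_br (bcover_alpha x) (bcover_alpha y).
Proof. by rewrite /bcover_br bcover_alphaE !bcover_proj_alpha. Qed.

HB.instance Definition _ := isHomLeibniz.Build F bcover
  (hl_br := bilinear_of bcover_br_bilinear) (hl_alpha := bcover_alpha)
  bcover_homleibniz bcover_multiplicative.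

Definition bcover_morph : {hlmorphism bcover -> K} :=
  @hlmorphism_of F bcover K bcover_proj
    (fun s t => bcover_proj_btens (bcover_proj s) (bcover_proj t))
    bcover_proj_alpha.

Lemma bcover_morph_surj : perfect K -> forall x, exists s, bcover_morph s = x.
Proof.
move=> pK x; have [t dt] := d2_surj pK (- x).
by exists (bcover_pi t); rewrite [LHS]bcover_projE dt opprK.
Qed.

(** Since [bcover_morph] is onto, each generator is [btens (u v) (u w)] with [u := bcover_morph],
    which is the bracket of [v] and [w]. *)
Lemma bcover_perfect : perfect K -> perfect bcover.
Proof.
move=> pK s; have [t <-] := bcover_piP s; elim/tensor_ind: t => [x y|a t u ht hu].
  have [v <-] := bcover_morph_surj pK x; have [w <-] := bcover_morph_surj pK y.
  by apply: mem_lin_span; exists v, w.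
by rewrite linearP; apply: rpredD; first exact: rpredZ.
Qed.

(** The kernel of [bcover_morph] is [ker d2 / im d3]. *)
Lemma bcover_morph_inj_HL2 : injective bcover_morph -> forall x : HL2 K, x = 0.
Proof.
move=> uinj; apply/HL2_eq0 => t dt; apply/bcover_pi_eq0/uinj.
by rewrite [LHS]bcover_projE dt oppr0 linear0.
Qed.

(** By perfectness [x] may be taken to be a bracket [[y, z]]. Then [btens_alpha_br] at [m, y, z] and
    at [y, z, m] gives the two equations, all other terms containing a bracket with [m]. *)
Lemma btens_alpha_central (m x : K) : perfect K -> hl_central m ->
  btens (hl_alpha m) x = 0 /\ btens x (hl_alpha m) = 0.
Proof.
move=> pK mc; have lr0 (y : K) : btens y 0 = 0 by rewrite linear0r.
have l0 (y : K) : btens 0 y = 0 by rewrite linear0l.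
have llin : linear (btens (hl_alpha m)) by move=> a u v; exact: linearPr.
have rlin : linear (btens^~ (hl_alpha m)) by move=> a u v; exact: linearPl.
split.
  apply: (perfect_linear_eq (f := linear_of llin) (g := \0)) => // y z /=.
  by rewrite btens_alpha_br !(mc _).1 !l0 subrr.
apply: (perfect_linear_eq (f := linear_of rlin) (g := \0)) => // y z.
have := btens_alpha_br y z m; rewrite !(mc _).2 l0 lr0 subr0 => e.
exact: esym e.
Qed.

End BracketCover.

(** * Composites and identities *)

Section Composition.
Variables (F : fieldType) (K L E : homLeibnizType F).
Variables (g : {hlmorphism L -> E}) (f : {hlmorphism K -> L}).

Fact hlcomp_br x y : (g \o f) (hl_br x y) = hl_br ((g \o f) x) ((g \o f) y).
Proof. by rewrite /= !hlmorph_br. Qed.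

Fact hlcomp_alpha x : (g \o f) (hl_alpha x) = hl_alpha ((g \o f) x).
Proof. by rewrite /= !hlmorph_alpha. Qed.

Definition hlcomp : {hlmorphism K -> E} :=
  hlmorphism_of (f := g \o f) hlcomp_br hlcomp_alpha.

End Composition.

Definition hlid (F : fieldType) (K : homLeibnizType F) : {hlmorphism K -> K} :=
  hlmorphism_of (f := idfun) (fun _ _ => erefl) (fun _ => erefl).

(** * Vanishing of [HL1] and [HL2] for a universal alpha-central extension *)

Section CentralExtensions.
Variables (F : fieldType) (M K L : homLeibnizType F).
Variables (i : {hlmorphism M -> K}) (pi : {hlmorphism K -> L}).

Lemma central_extension_ker :
  central_extension i pi -> forall x, pi x = 0 -> hl_central x.
Proof. by move=> [[_ ker _] iZ] x /ker[m <-]. Qed.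

Lemma central_extension_surj :
  central_extension i pi -> forall y, exists x, pi x = y.
Proof. by move=> [[]]. Qed.

(** Replacing one argument at a time changes it by an element of the kernel, which is central. Thus
    brackets in [K] depend only on images in [L]. *)
Lemma central_extension_br : central_extension i pi ->
  forall x x' y y', pi x = pi x' -> pi y = pi y' -> hl_br x y = hl_br x' y'.
Proof.
move=> ce x x' y y' ex ey.
have central_sub u v : pi u = pi v -> hl_central (u - v).
  by move=> e; apply: central_extension_ker => //; rewrite linearB /= e subrr.
have /eqP := (central_sub _ _ ex y).1; rewrite linearBl subr_eq0 => /eqP ->.
by have /eqP := (central_sub _ _ ey x').2; rewrite linearBr subr_eq0 => /eqP.
Qed.

Lemma universal_alpha_central_lift : universal_alpha_central_extension i pi ->
  forall (K' : homLeibnizType F) (pi' : {hlmorphism K' -> L}),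
  (forall y, exists x, pi' x = y) ->
  (forall x, pi' x = 0 -> hl_central (hl_alpha x)) -> unique_lift pi pi'.
Proof.
move=> [_ univ] K' pi' surj cent.
apply: (univ _ _ (hlker_incl pi') pi'); split; first exact: hlker_exact.
by move=> m; apply: cent; exact: hlker_val.
Qed.

Lemma unique_lift_eq (K' : homLeibnizType F) (pi' : {hlmorphism K' -> L})
    (f g : {hlmorphism K -> K'}) : unique_lift pi pi' ->
  (forall x, pi' (f x) = pi x) -> (forall x, pi' (g x) = pi x) -> f =1 g.
Proof. by move=> [h [_ hu]] /hu fh /hu gh x; rewrite fh gh. Qed.

Lemma universal_alpha_central_perfect :
  universal_alpha_central_extension i pi -> perfect K.
Proof.
move=> uce x; have ce := uce.1.
pose p := hlprod_fst L (abelianization K).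
have lp : unique_lift pi p.
  apply: universal_alpha_central_lift => // [y|[y q] py z].
    by exists (y, 0).
  (* The kernel is the abelian factor, whose brackets all vanish. *)
  have -> : y = 0 by exact: py.
  by split; apply/pair_equal_spec; rewrite /= linear0 ?linear0l ?linear0r.
apply/lquot_pi_eq0.
(* Equality of the second components says that the class of [x] in [K/[K,K]] is zero. *)
have := unique_lift_eq (f := hlpair_morph pi (ab_morph K))
  (g := hlpair_morph pi (hlzero K (abelianization K))) lp
  (fun _ => erefl) (fun _ => erefl) x.
by move=> /pair_equal_spec[].
Qed.

Lemma universal_alpha_central_HL2 :
  universal_alpha_central_extension i pi -> forall x : HL2 K, x = 0.
Proof.
move=> uce; have ce := uce.1; have pK := universal_alpha_central_perfect uce.
pose u := bcover_morph K.
have usurj := bcover_morph_surj pK.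
have [h [uh _]] : unique_lift pi (hlcomp pi u).
  apply: universal_alpha_central_lift => // [y|s ps t].
    have [x <-] := central_extension_surj ce y.
    by have [s <-] := usurj x; exists s.
  (* The bracket of the cover reads its arguments through [u], and [u] sends [alpha s] to
     [alpha (u s)] with [u s] in [ker pi], hence central. *)
  have sc : hl_central (u s) by exact: central_extension_ker ps.
  have [e1 e2] := btens_alpha_central (u t) pK sc.
  by split; rewrite [LHS]/= /bcover_br bcover_proj_alpha.
(* Both maps lift [pi] through [pi] itself, which is a test extension because a central extension is
   alpha-central. *)
have uhK : hlcomp u h =1 hlid K.
  apply: (@unique_lift_eq K pi (hlcomp u h) (hlid K) _ uh (fun _ => erefl)).
  apply: universal_alpha_central_lift => // [|x px].
    exact: central_extension_surj.
  by apply: central_extension_ker => //; rewrite hlmorph_alpha px linear0.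
(* On a bracket [[s, t]] both sides are of the form [btens] of images under [u], and [u h u = u] by
   [uhK]. *)
have hu : hlcomp h u =1 hlid (bcover K).
  apply: (perfect_linear_eq (bcover_perfect pK)) => s t.
  rewrite [LHS]hlmorph_br [LHS]/= /bcover_br.
  by congr (btens _ _); exact: uhK.
apply: bcover_morph_inj_HL2 => s t e.
exact: etrans (esym (hu s)) (etrans (congr1 h e) (hu t)).
Qed.

End CentralExtensions.

(** * Lifting a perfect algebra [E] with [HL2 E = 0] through a central extension [K] of [L] *)

Section CentralLift.
Variables (F : fieldType) (M K L : homLeibnizType F).
Variables (i : {hlmorphism M -> K}) (pi : {hlmorphism K -> L}).
Variables (E : homLeibnizType F) (f : {hlmorphism E -> L}).
Hypothesis ce : central_extension i pi.

(** An arbitrary set-theoretic choice; only brackets of such preimages are canonical. *)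
Definition preim (x : E) : K := sval (cid (central_extension_surj ce (f x))).

Lemma preimK x : pi (preim x) = f x.
Proof. by rewrite /preim; case: cid. Qed.

Definition preim_br (x y : E) : K := hl_br (preim x) (preim y).

Lemma preim_brE x y x' y' :
  pi x' = f x -> pi y' = f y -> preim_br x y = hl_br x' y'.
Proof. by move=> ex ey; apply: (central_extension_br ce); rewrite preimK. Qed.

Fact preim_br_bilinear : bilinear_for *:%R *:%R preim_br.
Proof.
split=> [y|x] a u v /=; rewrite /preim_br.
  rewrite -hl_brDl; apply: preim_brE; last exact: preimK.
  by rewrite !linearP /= !preimK.
rewrite -hl_brDr; apply: preim_brE; first exact: preimK.
by rewrite !linearP /= !preimK.
Qed.

(** As [preim_br] may be computed with any preimages, take those of [hl_br x y] and [hl_alpha z] to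
    be the bracket and twist of preimages. The claim becomes the Hom-Leibniz identity in [K]. *)
Lemma preim_br_homleibniz x y z :
  - preim_br (hl_br x y) (hl_alpha z) + preim_br (hl_br x z) (hl_alpha y)
  + preim_br (hl_alpha x) (hl_br y z) = 0.
Proof.
have br_lift u v : pi (preim_br u v) = f (hl_br u v).
  by rewrite !hlmorph_br !preimK.
have alpha_lift u : pi (hl_alpha (preim u)) = f (hl_alpha u).
  by rewrite !hlmorph_alpha preimK.
rewrite !(preim_brE (br_lift _ _) (alpha_lift _)).
rewrite (preim_brE (alpha_lift _) (br_lift _ _)) /preim_br hl_homleibniz.
by rewrite (addrC (- _)) addrA subrK subrr.
Qed.

Lemma central_lift : perfect E -> (forall x : HL2 E, x = 0) -> unique_lift f pi.
Proof.
move=> pE /HL2_eq0 h2; pose phi := tensor_lift (bilinear_of preim_br_bilinear).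
have phiE x y : phi (tens x y) = preim_br x y by exact: tensor_liftE.
(* [- d2] is onto because [E] is perfect, and its kernel consists of boundaries because [HL2 E = 0];
   [phi] kills boundaries. *)
have [||h hE] := linear_factor (p := \- d2 E) (f := phi).
- by move=> x; have [t dt] := d2_surj pE (- x); exists t; rewrite /= dt opprK.
- move=> t /= /eqP; rewrite oppr_eq0 => /eqP/h2[s <-].
  apply: linear_d3_eq0 => x y z; rewrite !linearD linearN /= !phiE.
  exact: preim_br_homleibniz.
have h_br x y : h (hl_br x y) = preim_br x y.
  by rewrite -phiE -hE /= d2E opprK.
have pih x : pi (h x) = f x.
  move: x; apply: (perfect_linear_eq (f := pi \o h)) => // x y.
  by rewrite /= h_br !hlmorph_br !preimK.
have hbr x y : h (hl_br x y) = hl_br (h x) (h y).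
  by rewrite h_br; apply: preim_brE.
(* On brackets both sides are brackets in [K] whose arguments have the same images in [L]. *)
have halpha x : h (hl_alpha x) = hl_alpha (h x).
  move: x; apply: (perfect_linear_eq (f := h \o hl_alpha) (g := hl_alpha \o h)).
    exact: pE.
  move=> x y; rewrite /= hl_multiplicative !hbr hl_multiplicative.
  by apply: (central_extension_br ce); rewrite pih !hlmorph_alpha pih.
exists (hlmorphism_of hbr halpha); split=> [|h' h'E]; first exact: pih.
(* Two lifts of [f] have the same images in [L], so they agree on brackets, which span [E]. *)
apply: perfect_linear_eq => // x y /=.
by rewrite hlmorph_br hbr; apply: (central_extension_br ce); rewrite h'E pih.
Qed.

End CentralLift.

Theorem corollary4p12 (F : fieldType) (M K L : homLeibnizType F)
    (i : {hlmorphism M -> K}) (pi : {hlmorphism K -> L}) :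
  (universal_alpha_central_extension i pi ->
     (forall x : HL1 K, x = 0) /\ (forall x : HL2 K, x = 0))
  /\
  (central_extension i pi ->
     (forall x : HL1 K, x = 0) /\ (forall x : HL2 K, x = 0) ->
     universal_central_extension i pi).
Proof.
split=> [uce|ce [/HL1_eq0 pK h2]].
  split; last exact: universal_alpha_central_HL2 uce.
  exact/HL1_eq0/(universal_alpha_central_perfect uce).
by split=> // M' K' i' pi' ce'; exact: (central_lift _ ce').
Qed.
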